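(* Fix a prime power $q$ and an integer $d\geq 1$. Then $$\mu(H_q(n,d))\;\geq\;\left(\frac{d(q-1)}{q^d-1}+o(1)\right)q^n\qquad (n\to\infty).$$ Moreover $\mu(H_q(n,d))\leq q^{n+d-1}$ for all $n\geq d$, so that $\mu(H_q(n,d))=\Theta_{q,d}(q^n)$ as $n\to\infty$.
   Context: Metric dimension: for a finite connected simple graph $G$ with graph distance $d(\cdot,\cdot)$, a set $S\subseteq V(G)$ is resolving if the map $x\mapsto (d(s,x))_{s\in S}$ is injective on $V(G)$; $\mu(G)$ is the minimum size of a resolving set. Bilinear forms graph: $H_q(n,d)$ has as vertices all $n\times d$ matrices over $\mathbb F_q$, two matrices being adjacent when their difference has rank $1$; the graph distance is $d(A,B)=\operatorname{rank}(A-B)$. Here $q,d$ are fixed, $o(1)$ tends to $0$ as $n\to\infty$, and $\Theta_{q,d}(q^n)$ means bounded above and below by positive constants (depending only on $q,d$) times $q^n$ for all large $n$. The upper bound $\mu(H_q(n,d))\leq q^{n+d-1}$ is a known result from the literature (Feng and Wang for $n\geq d+2$; Guo, Li and Wang for $n=d,d+1$). *)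

(* Defs.v *)
From mathcomp Require Import all_boot all_algebra.

Set Implicit Arguments.
Unset Strict Implicit.
Unset Printing Implicit Defensive.

Import GRing.Theory.

(* A finite simple graph is given by its adjacency relation on a finType. *)
Section MetricDimension.
Variables (T : finType) (e : rel T).

Definition has_walk (x y : T) (k : nat) : bool :=
  [exists p : k.-tuple T, path e x p && (last x p == y)].

(* Shortest walks have length < #|T|; the junk value for vertices in different
   components is #|T|, and never occurs in a connected graph. *)
Definition gdist (x y : T) : nat := find (has_walk x y) (iota 0 #|T|).

Definition resolving (S : {set T}) : bool :=
  injectiveb (fun x : T => [seq gdist s x | s <- enum S]).

(* The arg min is meaningful because the whole vertex set is resolving, see
   resolvingT. *)
Definition metric_dim : nat := #|[arg min_(S < [set: T] | resolving S) #|S|]|.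

Lemma gdistxx (x : T) : gdist x x = 0.
Proof.
rewrite /gdist; have := max_card (pred1 x); rewrite card1.
case: #|T| => // m _ /=.
suff -> : has_walk x x 0 by [].
by apply/existsP; exists [tuple]; rewrite /= eqxx.
Qed.

Lemma gdist_eq0 (x y : T) : gdist x y = 0 -> x = y.
Proof.
rewrite /gdist; have := max_card (pred1 x); rewrite card1.
case: #|T| => // m _ /=.
by case: ifP => // /existsP[p]; rewrite tuple0 /= => /eqP.
Qed.

Lemma resolvingT : resolving [set: T].
Proof.
apply/injectiveP => x y /eq_in_map h.
by apply: gdist_eq0; rewrite -h ?gdistxx // mem_enum in_setT.
Qed.

Lemma metric_dimP :
  (exists2 S, resolving S & #|S| = metric_dim) /\
  (forall S, resolving S -> metric_dim <= #|S|).
Proof.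
rewrite /metric_dim; case: arg_minnP => [|S rS minS]; first exact: resolvingT.
by split; [exists S | exact: minS].
Qed.

End MetricDimension.

Section BilinearForms.
Variables (F : finFieldType) (n d : nat).

Definition bilinear_forms_graph : rel 'M[F]_(n, d) :=
  fun A B => \rank (A - B)%R == 1.

Lemma bilinear_forms_sym : symmetric bilinear_forms_graph.
Proof.
by move=> A B; rewrite /bilinear_forms_graph -mxrank_opp opprB.
Qed.

Lemma bilinear_forms_irr : irreflexive bilinear_forms_graph.
Proof. by move=> A; rewrite /bilinear_forms_graph subrr mxrank0. Qed.

Lemma bilinear_forms_connected (A B : 'M[F]_(n, d)) :
  connect bilinear_forms_graph A B.
Proof.
have step C i j (a : F) :
    connect bilinear_forms_graph C (C + a *: delta_mx i j)%R.
  have [->|a0] := eqVneq a 0%R; first by rewrite scale0r addr0.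
  apply: connect1; rewrite bilinear_forms_sym /bilinear_forms_graph addrC addKr.
  by rewrite mxrank_scale_nz // mxrank_delta.
rewrite -[B](subrK A) addrC [(B - A)%R]matrix_sum_delta pair_big /=.
elim: (index_enum _) A (B - A)%R => [|ij r IH] C M.
  by rewrite big_nil addr0.
by rewrite big_cons addrA; apply: connect_trans (step _ _ _ _) (IH _ _).
Qed.

End BilinearForms.

(* Main.v *)
(* Distance in the graph is the rank of the difference.

   Lower bound: a resolving set S of size m embeds the N = q^(nd) vertices into
   {0..d}^m by A |-> (rank (C - A))_{C in S}.  Give a code word the weight
   t^(number of entries < d) with t = q^-n; the total weight of all words is
   (1 + d t)^m.  Each coordinate is < d on exactly B of the N vertices, where B
   counts the matrices of rank < d, so AM-GM over the vertices gives
   t^(m B) <= ((1 + d t)^m / N)^N.  Since B / N <= t (q^d - 1) / (q - 1), taking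
   logarithms yields n d q^n <= m (n (q^d - 1) / (q - 1) + d / ln q).

   Upper bound: the q^(n + d - 1) matrices [u | 1 c], with arbitrary first
   column u and all other columns constant, form a resolving set. *)

Require Import Defs.
From HB Require Import structures.
From mathcomp Require Import all_boot all_order all_algebra.
From mathcomp Require Import all_classical all_reals all_analysis.
From mathcomp Require Import ring.

Set Implicit Arguments.
Unset Strict Implicit.
Unset Printing Implicit Defensive.

Import Order.TTheory GRing.Theory Num.Theory.
Import numFieldNormedType.Exports.
Local Open Scope ring_scope.

(** * Graph distance as rank distance *)

Lemma has_walkP (T : finType) (e : rel T) (x y : T) (k : nat) :
  reflect (exists p, [/\ size p = k, path e x p & last x p = y])
          (has_walk e x y k).
Proof.
apply: (iffP existsP) => [[p /andP[ep /eqP py]] | [p [pk ep py]]].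
  by exists p; rewrite size_tuple.
have pkE : size p == k by apply/eqP.
by exists (Tuple pkE); rewrite /= ep py eqxx.
Qed.

(** The bound on [k] matters because [gdist] searches only lengths below [#|T|]. *)
Lemma gdist_unique (T : finType) (e : rel T) (x y : T) (k : nat) :
  (k < #|T|)%N -> has_walk e x y k ->
  (forall j, has_walk e x y j -> (k <= j)%N) -> gdist e x y = k.
Proof.
move=> ltkT walk_k min_k; apply/eqP; rewrite eqn_leq /gdist.
set a := has_walk e x y; set s := iota 0 #|T|; apply/andP; split.
  rewrite leqNgt; apply/negP => /(before_find 0%N).
  by rewrite nth_iota // add0n /a walk_k.
have has_a : has a s by apply/hasP; exists k => //; rewrite mem_iota.
have := nth_find 0%N has_a; rewrite nth_iota ?add0n; first exact: min_k.
by rewrite -(size_iota 0 #|T|) -has_find.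
Qed.

Section RankDistance.
Variables (F : finFieldType) (n d : nat).
Implicit Types A B C : 'M[F]_(n, d).

Lemma mxrank_path_leq A (p : seq 'M[F]_(n, d)) :
  path (@bilinear_forms_graph F n d) A p ->
  (\rank (A - last A p)%R <= size p)%N.
Proof.
elim: p A => [|C p IH] A /=; first by rewrite subrr mxrank0.
case/andP=> /eqP AC /IH le_p; rewrite -(subrK C A) -addrA.
by apply: leq_trans (mxrank_add _ _) _; rewrite AC add1n.
Qed.

(** In the factorization [col_ebase A *m pid_mx _ *m row_ebase A], the matrix [P] carries the last
    of the [k.+1] diagonal ones. *)
Lemma mxrank_split1 A k : \rank A = k.+1 ->
  exists P : 'M[F]_(n, d), \rank P = 1%N /\ \rank (A - P) = k.
Proof.
move=> rA; have ltkn : (k < n)%N by rewrite -rA rank_leq_row.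
have ltkd : (k < d)%N by rewrite -rA rank_leq_col.
have rankLU (M : 'M[F]_(n, d)) :
    \rank (col_ebase A *m M *m row_ebase A) = \rank M.
  rewrite mxrankMfree ?row_free_unit ?row_ebase_unit //.
  rewrite -mxrank_tr trmx_mul mxrankMfree ?mxrank_tr //.
  by rewrite row_free_unit unitmx_tr col_ebase_unit.
exists (col_ebase A *m delta_mx (Ordinal ltkn) (Ordinal ltkd) *m row_ebase A).
split; first by rewrite rankLU mxrank_delta.
rewrite -{1}[A]mulmx_ebase -mulmxBl -mulmxBr rankLU rA.
rewrite -[RHS](@rank_pid_mx F n d k) 1?ltnW //; congr (\rank _).
apply/matrixP => i j; rewrite !mxE -!val_eqE /= ltnS.
case: (ltngtP i k) => // [ik|ki|->]; rewrite ?andbT ?andbF ?subr0 //=.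
by rewrite eq_sym subrr.
Qed.

Lemma has_walk_rank A B :
  has_walk (@bilinear_forms_graph F n d) A B (\rank (A - B)).
Proof.
move: {2}(\rank _) (erefl (\rank (A - B))) => k.
elim: k A => [|k IH] A rAB; rewrite rAB; apply/has_walkP.
  move/eqP: rAB; rewrite mxrank_eq0 subr_eq0 => /eqP ->.
  by exists [::].
have [P [rP rABP]] := mxrank_split1 rAB.
have rC : \rank (A - P - B) = k by rewrite addrAC.
have := IH _ rC; rewrite rC => /has_walkP [p [sp ep lp]].
exists (A - P :: p); rewrite /= sp; split=> //.
by rewrite ep andbT /bilinear_forms_graph opprB addrC subrK rP.
Qed.

Lemma mxrank_lt_card A : (\rank A < #|{: 'M[F]_(n, d)}|)%N.
Proof.
rewrite card_mx; apply: leq_ltn_trans (ltn_expl _ (card_finNzRing_gt1 F)).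
(* The rank is compared with [n * d]: through [d] if [n > 0], through the number of rows if
   [n = 0]. *)
have [n0|n0] := posnP n; last first.
  by apply: leq_trans (rank_leq_col A) _; rewrite leq_pmull.
by have := rank_leq_row A; rewrite {2}n0 => /leq_trans ->.
Qed.

Lemma gdist_bilinear_forms A B :
  gdist (@bilinear_forms_graph F n d) A B = \rank (A - B).
Proof.
apply: gdist_unique => [||j /has_walkP [p [<- ep <-]]].
- exact: mxrank_lt_card.
- exact: has_walk_rank.
- exact: mxrank_path_leq.
Qed.

Lemma resolving_bilinear_formsP (S : {set 'M[F]_(n, d)}) :
  reflect (forall A B, (forall C, C \in S -> \rank (C - A) = \rank (C - B)) ->
             A = B)
          (resolving (@bilinear_forms_graph F n d) S).
Proof.
apply: (iffP (injectiveP _)) => [inj A B eqr | sepS A B /eq_in_map eqAB].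
  apply: inj; apply/eq_in_map => C; rewrite mem_enum => CS.
  by rewrite !gdist_bilinear_forms eqr.
apply: sepS => C CS; rewrite -!gdist_bilinear_forms.
by apply: eqAB; rewrite mem_enum.
Qed.

End RankDistance.

(** * The resolving set for the upper bound *)

(** Lets ranks of bordered matrices detect membership in a column space; the transposes are there
    because [<=] compares row spaces. *)
Lemma mxrank_row_mx_colP (F : fieldType) n m (x : 'cV[F]_n) (M : 'M[F]_(n, m)) :
  (\rank (row_mx x M) == \rank M) = (x^T <= M^T)%MS.
Proof.
rewrite -mxrank_tr tr_row_mx -(mxrank_tr M) -addsmxE eq_sym.
rewrite (mxrank_leqif_sup (addsmxSr x^T M^T)).
by rewrite addsmx_sub submx_refl andbT.
Qed.

Section UpperBound.
Variables (F : finFieldType) (n m : nat).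

Definition const_rows_mx (uc : 'cV[F]_n * 'rV[F]_m) : 'M[F]_(n, 1 + m) :=
  row_mx uc.1 (\matrix_i uc.2).

Definition const_rows_set : {set 'M[F]_(n, 1 + m)} :=
  [set const_rows_mx uc | uc : 'cV_n * 'rV_m].

Lemma card_const_rows_set : (#|const_rows_set| <= #|F| ^ (n + m))%N.
Proof.
apply: leq_trans (leq_imset_card _ _) _.
by rewrite card_prod !card_mx muln1 mul1n expnD.
Qed.

Lemma submx_tr_row0 k (y : 'cV[F]_n) (N : 'M[F]_(n, k)) i :
  (y^T <= N^T)%MS -> row i N = 0 -> y i 0 = 0.
Proof.
case/submxP => D /(congr1 trmx); rewrite trmx_mul !trmxK => -> Ni.
have := congr1 (fun z : 'rV_1 => z 0 0) (row_mul i N D^T).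
by rewrite Ni mul0mx !mxE.
Qed.

(* With [c] the [i]-th row of [X'], the ranks of [x - u | X' - 1 c], for [u]
   varying, determine the coset of [x] modulo the column space of [X' - 1 c],
   on which the [i]-th coordinate is constant. *)
Lemma resolving_const_rows :
  resolving (@bilinear_forms_graph F n (1 + m)) const_rows_set.
Proof.
apply/resolving_bilinear_formsP => X Y; rewrite -[X]hsubmxK -[Y]hsubmxK.
move: (lsubmx X) (rsubmx X) (lsubmx Y) (rsubmx Y) => x X' z Z' eq_rank.
apply/row_matrixP => i.
set M := \matrix_i0 row i X' - X'; set N := \matrix_i0 row i X' - Z'.
have eqMN u : \rank (row_mx (u - x) M) = \rank (row_mx (u - z) N).
  have := eq_rank (const_rows_mx (u, row i X')); rewrite /const_rows_mx /=.
  by rewrite !opp_row_mx !add_row_mx; apply;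
  exact: (imset_f const_rows_mx (x := (u, _)) isT).
have rank_row0 (y : 'M[F]_(n, m)) : \rank (row_mx (0 : 'cV_n) y) = \rank y.
  by apply/eqP; rewrite mxrank_row_mx_colP trmx0 sub0mx.
have rank_ge (y : 'cV[F]_n) (P : 'M[F]_(n, m)) :
    (\rank P <= \rank (row_mx y P))%N.
  rewrite -mxrank_tr -(mxrank_tr (row_mx _ _)) tr_row_mx -addsmxE.
  exact: mxrankS (addsmxSr _ _).
(* Taking [u = z], then [u = x], makes the border vanish on one side and yields one inequality
   each. *)
have rMN : \rank M = \rank N.
  apply/eqP; rewrite eqn_leq; apply/andP; split.
    by have := eqMN z; rewrite subrr rank_row0 => <-.
  by have := eqMN x; rewrite subrr rank_row0 => ->.
have eq_coset u : ((u - x)^T <= M^T)%MS = ((u - z)^T <= N^T)%MS.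
  by rewrite -!mxrank_row_mx_colP eqMN rMN.
have zx : ((z - x)^T <= M^T)%MS by rewrite eq_coset subrr trmx0 sub0mx.
(* The cosets of [x] modulo the columns of [M] and of [z] modulo those of [N] coincide, so
   [w + z - x] lies in the column space of [M], as does [z - x]. *)
have NM (w : 'cV[F]_n) : (w^T <= N^T)%MS -> (w^T <= M^T)%MS.
  move=> wN; have := eq_coset (w + z); rewrite addrK wN => wM.
  have -> : w = w + z - x - (z - x) by rewrite opprB addrA subrK addrK.
  by rewrite linearB /= addmx_sub // eqmx_opp.
have Mi : row i M = 0.
  by apply/rowP => j; rewrite !mxE subrr.
have coord0 (w : 'cV[F]_n) : (w^T <= M^T)%MS -> w i 0 = 0.
  by move=> wM; apply: submx_tr_row0 wM Mi.
apply/rowP => j; rewrite !mxE; case: fintype.split => k.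
  have := coord0 _ zx; rewrite !mxE ord1 => /eqP.
  by rewrite subr_eq0 eq_sym => /eqP.
(* Each column of [N] lies in the column space of [M], so its [i]-th entry, the difference of the
   entries of [X'] and [Z'], is zero. *)
have /NM/coord0 : ((col k N)^T <= N^T)%MS by rewrite tr_col row_sub.
by rewrite !mxE => /eqP; rewrite subr_eq0 => /eqP.
Qed.

End UpperBound.

(** * Counting matrices of rank below [d] *)

Section SingularCount.
Variables (F : finFieldType) (n d : nat).

(** If [v j] is nonzero, [A *m v = 0] determines column [j] of [A] from the others, so deleting that
    column is injective. *)
Lemma card_mx_annihilating (v : 'cV[F]_d) : v != 0 ->
  (#|[set A : 'M[F]_(n, d) | A *m v == 0%R]| <= #|F| ^ (n * d.-1))%N.
Proof.
case/cV0Pn => j vj; rewrite -card_mx.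
apply: (@leq_card_in _ _ (col' j)) => A B.
rewrite !inE => /eqP Av /eqP Bv /matrixP eqAB; apply/eqP; rewrite -subr_eq0.
have D0 i k : k != j -> (A - B) i k = 0.
  rewrite eq_sym => /unlift_some[l -> _]; have := eqAB i l; rewrite !mxE => ->.
  by rewrite subrr.
apply/eqP/matrixP => i k; rewrite [RHS]mxE; have [->|/D0 //] := eqVneq k j.
have /matrixP/(_ i 0) : (A - B) *m v = 0 by rewrite mulmxBl Av Bv subrr.
rewrite [LHS]mxE [RHS]mxE (bigD1 j) //= big1 => [|l /D0 ->]; last exact: mul0r.
by rewrite addr0 => /eqP; rewrite mulf_eq0 (negPf vj) orbF => /eqP.
Qed.

(** The kernel contains a line, which has [#|F|.-1] nonzero vectors. *)
Lemma card_kernel_nonzero (A : 'M[F]_(n, d)) : (\rank A < d)%N ->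
  (#|F|.-1 <= #|[set v : 'cV[F]_d | (v != 0%R) && (A *m v == 0%R)]|)%N.
Proof.
move=> rA; have : kermx A^T != 0.
  by rewrite kermx_eq0 /row_free mxrank_tr neq_ltn rA.
case/rowV0Pn => u /sub_kermxP uA u0; have v0 : u^T != 0 by rewrite trmx_eq0.
have Av : A *m u^T = 0 by apply: trmx_inj; rewrite trmx_mul trmxK uA trmx0.
have inj : injective (fun a : F => a *: u^T).
  move=> a b /eqP; rewrite -subr_eq0 -scalerBl scaler_eq0 (negPf v0) orbF.
  by rewrite subr_eq0 => /eqP.
rewrite -(cardsC1 (0 : F)) -(card_imset _ inj) subset_leq_card //.
apply/fintype.subsetP => _ /imsetP[a + ->]; rewrite !inE => a0.
by rewrite scaler_eq0 negb_or a0 v0 -scalemxAr Av scaler0 eqxx.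
Qed.

(** Double counting of pairs [(A, v)] with [v] nonzero and [A *m v = 0]. *)
Lemma card_mx_rank_lt :
  (#|[set A : 'M[F]_(n, d) | (\rank A < d)%N]| * #|F|.-1
     <= (#|F| ^ d).-1 * #|F| ^ (n * d.-1))%N.
Proof.
rewrite -sum_nat_const.
apply: (@leq_trans (\sum_(A in [set A : 'M[F]_(n, d) | (\rank A < d)%N])
          \sum_(v : 'cV[F]_d | (v != 0%R) && (A *m v == 0%R)) 1)%N).
  apply: leq_sum => A; rewrite inE => /card_kernel_nonzero.
  by rewrite sum1dep_card.
rewrite (exchange_big_dep (fun v : 'cV[F]_d => v != 0%R)) /=; last first.
  by move=> A v _ /andP[].
have -> : (#|F| ^ d).-1 = #|[set~ 0%R : 'cV[F]_d]|.
  by rewrite cardsC1 card_mx muln1.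
rewrite -sum_nat_const [leqRHS](eq_bigl (fun v => v != 0%R)); last first.
  by move=> v; rewrite !inE.
apply: leq_sum => v v0; rewrite sum1dep_card.
apply: leq_trans (card_mx_annihilating v0); apply: subset_leq_card.
by apply/fintype.subsetP => A; rewrite !inE => /and3P[].
Qed.

End SingularCount.

(** * Weights of code words *)

(** Expanding the power gives one nonnegative term for each word in [{ffun I -> J}]; injectivity
    makes the left side a sum over distinct words. *)
Lemma sum_prod_code_le (R : numDomainType) (T I J : finType)
    (code : T -> {ffun I -> J}) (w : J -> R) :
  injective code -> (forall j, 0 <= w j) ->
  \sum_x \prod_i w (code x i) <= (\sum_j w j) ^+ #|I|.
Proof.
move=> inj_code w0.
rewrite -prodr_const (bigA_distr_bigA (fun _ => w)) /=.
rewrite -(big_imset (fun f : {ffun I -> J} => \prod_i w (f i))) /=; last first.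
  by move=> x y _ _; apply: inj_code.
rewrite [leRHS](bigID (mem (code @: T))) /= lerDl sumr_ge0 // => f _.
exact: prodr_ge0.
Qed.

(* Kraft's inequality combined with AM-GM, in place of subadditivity of
   entropy. *)
Lemma prod_code_le (R : numFieldType) (T I J : finType)
    (code : T -> {ffun I -> J}) (w : J -> R) :
  injective code -> (forall j, 0 <= w j) ->
  \prod_x \prod_i w (code x i) <= ((\sum_j w j) ^+ #|I| / #|T|%:R) ^+ #|T|.
Proof.
move=> inj_code w0.
have P0 x : 0 <= \prod_i w (code x i) by apply: prodr_ge0.
have [le_AGM _] := leif_AGM (fun x (_ : x \in T) => P0 x).
apply: le_trans le_AGM _.
rewrite lerXn2r ?nnegrE ?divr_ge0 ?ler0n ?exprn_ge0 ?sumr_ge0 //.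
by rewrite ler_wpM2r ?invr_ge0 ?ler0n // sum_prod_code_le.
Qed.

(** * Lower bound on the size of a resolving set *)

Section LowerBound.
Variables (R : realType) (F : finFieldType) (n d : nat).

(** The bijection [A |-> C - A] makes the count of low ranks independent of [C]. *)
Lemma prod_if_rank_lt (C : 'M[F]_(n, d)) (t : R) :
  \prod_(A : 'M[F]_(n, d)) (if (\rank (C - A)%R < d)%N then t else 1)
    = t ^+ #|[set A : 'M[F]_(n, d) | (\rank A < d)%N]|.
Proof.
have inj : injective (fun A => C - A) by move=> A B /addrI/oppr_inj.
rewrite [LHS](reindex_inj inj) -big_mkcond /= -prodr_const.
by apply: eq_bigl => A; rewrite inE subKr.
Qed.

Lemma resolving_prod_le (S : {set 'M[F]_(n, d)}) (t : R) : 0 <= t ->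
  resolving (@bilinear_forms_graph F n d) S ->
  t ^+ (#|[set A : 'M[F]_(n, d) | (\rank A < d)%N]| * #|S|)
    <= ((1 + d%:R * t) ^+ #|S| / (#|F| ^ (n * d))%:R) ^+ (#|F| ^ (n * d)).
Proof.
move=> t0 /resolving_bilinear_formsP sepS.
pose code (A : 'M[F]_(n, d)) : {ffun 'I_#|S| -> 'I_d.+1} :=
  [ffun i => inord (\rank (enum_val i - A))].
have codeE A i : code A i = \rank (enum_val i - A) :> nat.
  by rewrite ffunE inordK // ltnS rank_leq_col.
have inj_code : injective code.
  move=> A B eqAB; apply: sepS => C CS.
  by have := codeE A (enum_rank_in CS C); rewrite eqAB codeE enum_rankK_in.
pose w (j : 'I_d.+1) : R := if (j < d)%N then t else 1.
have w0 j : 0 <= w j by rewrite /w; case: ifP.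
have := prod_code_le inj_code w0.
have sumw : \sum_j w j = 1 + d%:R * t.
  rewrite big_ord_recr /w ltnn (eq_bigr (fun=> t)) => [|j _] /=.
    by rewrite sumr_const card_ord mulr_natl addrC.
  by rewrite ltn_ord.
(* Exchanging the products collects, for each element of [S], the factors of all vertices. *)
rewrite sumw card_ord card_mx exchange_big /=.
rewrite (eq_bigr (fun _ => t ^+ #|[set A : 'M[F]_(n, d) | (\rank A < d)%N]|)).
  by rewrite prodr_const card_ord -exprM.
move=> i _; rewrite -(prod_if_rank_lt (enum_val i)).
by apply: eq_bigr => A _; rewrite /w codeE.
Qed.

Lemma resolving_log_le (S : {set 'M[F]_(n, d)}) (q : R := #|F|%:R) :
  resolving (@bilinear_forms_graph F n d) S ->
  (n * d)%:R * q ^+ n * q ^+ (n * d) * ln q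
    <= #|S|%:R * (d%:R * q ^+ (n * d)
         + q ^+ n * #|[set A : 'M[F]_(n, d) | (\rank A < d)%N]|%:R * n%:R
           * ln q).
Proof.
move=> rS; have q1 : 1 < q by rewrite ltr1n card_finNzRing_gt1.
have q0 : 0 < q by apply: lt_trans q1.
have qn0 k : 0 < q ^+ k by rewrite exprn_gt0.
set t := (q ^+ n)^-1; have t0 : 0 < t by rewrite invr_gt0.
have := resolving_prod_le (ltW t0) rS; set B := #|_|; set m := #|S|.
have dt0 : 0 < 1 + d%:R * t by rewrite ltr_pwDl ?ltr01 // mulr_ge0 // ltW.
rewrite natrX -/q => le_prod.
have : ln (t ^+ (B * m)) <=
    ln (((1 + d%:R * t) ^+ m / q ^+ (n * d)) ^+ (#|F| ^ (n * d))).
  by rewrite ler_ln ?posrE ?exprn_gt0 ?divr_gt0 ?exprn_gt0.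
rewrite !lnXn ?divr_gt0 ?exprn_gt0 // ln_div ?posrE ?exprn_gt0 //.
rewrite !lnXn // lnV ?posrE // lnXn // -[_ *+ (B * m)]mulr_natr.
rewrite -[_ *+ (#|F| ^ _)]mulr_natr -[_ *+ m]mulr_natr -[_ *+ (n * d)]mulr_natr.
rewrite -[_ *+ n]mulr_natr natrX -/q !natrM.
(* This is [ln (1 + x) <= x] at [x = d t], scaled by [q ^+ n = 1 / t]. *)
have le_ln : q ^+ n * ln (1 + d%:R * t) <= d%:R.
  have {2}-> : d%:R = q ^+ n * (d%:R * t).
    by rewrite mulrCA mulfV ?mulr1 // gt_eqF.
  have dt_ge0 : 0 <= d%:R * t by rewrite mulr_ge0 // ltW.
  by rewrite ler_pM2l // le_ln1Dx // (lt_le_trans _ dt_ge0) ?oppr_lt0.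
move: (qn0 n) (qn0 (n * d)%N) le_ln.
move: (q ^+ n) (q ^+ (n * d)) (ln q) (ln _).
move=> Q N L l Q0 N0 le_ln; rewrite -subr_ge0 => le_prod'.
(* The goal is [Q] times the logarithmic inequality plus this multiple of [le_ln]. *)
have : 0 <= N * m%:R * (d%:R - Q * l).
  by rewrite mulr_ge0 ?subr_ge0 // mulr_ge0 // ltW.
move=> /(addr_ge0 (mulr_ge0 (ltW Q0) le_prod')).
rewrite -[X in _ -> is_true X]subr_ge0.
by congr (0 <= _); ring.
Qed.

Lemma metric_dim_lower_bound (q : R := #|F|%:R) : (0 < d)%N ->
  (n%:R * d%:R) * q ^+ n
    <= (n%:R * ((q ^+ d - 1) / (q - 1)) + d%:R / ln q)
       * (metric_dim (@bilinear_forms_graph F n d))%:R.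
Proof.
move=> d0; have [[S rS <-] _] := metric_dimP (@bilinear_forms_graph F n d).
have q1 : 1 < q by rewrite ltr1n card_finNzRing_gt1.
have q0 : 0 < q by apply: lt_trans q1.
have L0 : 0 < ln q by apply: ln_gt0.
have := resolving_log_le rS; rewrite -/q.
have := card_mx_rank_lt F n d; set B := #|_|; rewrite -(ler_nat R) !natrM.
have predR k : (0 < k)%N -> (k.-1)%:R = k%:R - 1 :> R.
  by move=> k0; rewrite -{2}(prednK k0) -natr1 addrK.
have F0 : (0 < #|F|)%N by apply: ltn_trans (card_finNzRing_gt1 F).
rewrite !predR ?expn_gt0 ?F0 // !natrX -/q => le_B.
have -> : q ^+ (n * d) = q ^+ n * q ^+ (n * d.-1).
  by rewrite -exprD -mulnS prednK.
set K := (q ^+ d - 1) / (q - 1).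
(* Relative to all [q ^+ (n * d)] matrices, the singular ones have density at most [K / q ^+ n]. *)
have {}le_B : B%:R <= K * q ^+ (n * d.-1).
  by rewrite mulrAC ler_pdivlMr ?subr_gt0.
move: (exprn_gt0 n q0) (exprn_gt0 (n * d.-1) q0) le_B L0.
move: (q ^+ n) (q ^+ (n * d.-1)) (ln q) => Q P L Q0 P0 le_B L0 le_log.
(* Scaling by [Q * P * L] brings the goal to the form of [le_log], with [B] replaced by its bound
   [K * P]. *)
rewrite -(ler_pM2r (mulr_gt0 (mulr_gt0 Q0 P0) L0)).
have -> : (n%:R * K + d%:R / L) * #|S|%:R * (Q * P * L)
    = #|S|%:R * (d%:R * (Q * P) + Q * (K * P) * n%:R * L).
  by field; rewrite gt_eqF.
apply: le_trans (le_trans le_log _).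
  by rewrite le_eqVlt; apply/orP; left; apply/eqP; ring.
rewrite ler_wpM2l // lerD2l !ler_wpM2r ?ler_wpM2l //; exact: ltW.
Qed.

End LowerBound.

(** * Bounds on the metric dimension and asymptotics *)

Lemma metric_dim_upper_bound (F : finFieldType) (n d : nat) : (0 < d)%N ->
  (metric_dim (@bilinear_forms_graph F n d) <= #|F| ^ (n + d - 1))%N.
Proof.
case: d => // m _; rewrite addnS subn1 /=.
have [_ min_dim] := metric_dimP (@bilinear_forms_graph F n m.+1).
apply: leq_trans (card_const_rows_set F n m).
exact/min_dim/resolving_const_rows.
Qed.

Local Open Scope classical_set_scope.

Theorem theorem4p1 (R : realType) (q d : nat) (F : finFieldType)
    (hq : #|F| = q) (hd : (1 <= d)%N) :
  let mu n := metric_dim (@bilinear_forms_graph F n d) in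
  [/\ exists eps : nat -> R,
        (eps n @[n --> \oo] --> 0) /\
        (forall n : nat,
           (d%:R * (q%:R - 1) / (q%:R ^+ d - 1) + eps n) * q%:R ^+ n
             <= (mu n)%:R),
      (forall n : nat, (d <= n)%N -> (mu n <= q ^ (n + d - 1))%N)
    & exists c C : R, [/\ 0 < c, 0 < C &
        exists N : nat, forall n : nat, (N <= n)%N ->
          c * q%:R ^+ n <= (mu n)%:R <= C * q%:R ^+ n]].
Proof.
move=> mu.
have q1 : 1 < q%:R :> R by rewrite -hq ltr1n card_finNzRing_gt1.
have q0 : 0 < q%:R :> R by apply: lt_trans q1.
have L0 : 0 < ln (q%:R : R) by apply: ln_gt0.
have d0 : 0 < d%:R :> R by rewrite ltr0n.
have qd1 : 0 < q%:R ^+ d - 1 :> R by rewrite subr_gt0 exprn_egt1 // -lt0n.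
have q10 : 0 < q%:R - 1 :> R by rewrite subr_gt0.
set K : R := (q%:R ^+ d - 1) / (q%:R - 1).
have K0 : 0 < K by apply: divr_gt0.
(* The error term coming from [ln (1 + d t) <= d t]; it stays bounded while the main term [n K]
   grows. *)
pose a : R := d%:R / ln q%:R; have a0 : 0 < a by apply: divr_gt0.
have lower n : n%:R * d%:R * q%:R ^+ n <= (n%:R * K + a) * (mu n)%:R :> R.
  by have := metric_dim_lower_bound R F n hd; rewrite hq.
have upper n : (mu n <= q ^ (n + d - 1))%N.
  by rewrite -hq; apply: metric_dim_upper_bound.
have den0 n : 0 < n%:R * K + a by rewrite ltr_wpDl // mulr_ge0 // ltW.
split.
(* This [eps n] is exactly [n d / (n K + a) - d / K], the gap between the finite bound and its
   limit. *)
- exists (fun n => - (d%:R * a / K) / (n%:R * K + a)); split.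
    rewrite -(mulr0 (- (d%:R * a / K))); apply: cvgM; first exact: cvg_cst.
    apply/gtr0_cvgV0; first by apply: nearW => n; apply: den0.
    have nK_cvg : (n%:R * K : R) @[n --> \oo] --> +oo%R.
      have id_cvg := @cvgr_idn R.
      exact: (@gt0_cvgMly R ((fun n => n%:R : R) @ \oo) _ K id K0 id_cvg).
    apply: ger_cvgy nK_cvg; apply: nearW => n.
    by rewrite lerDl ltW.
  have -> : d%:R * (q%:R - 1) / (q%:R ^+ d - 1) = d%:R / K :> R.
    by rewrite /K invf_div mulrA.
  move=> n; rewrite -(ler_pM2l (den0 n)); apply: le_trans (lower n).
  rewrite le_eqVlt; apply/orP; left; apply/eqP.
  by field; rewrite !gt_eqF // den0.
- by move=> n _; apply: upper.
(* For [n >= 1] one has [n K + a <= n (K + a)], whence the lower constant; the upper one comes from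
   [q ^ (n + d - 1)] by splitting off [q ^ n]. *)
- exists (d%:R / (K + a)), (q%:R ^+ (d - 1)).
  have Ka0 : 0 < K + a by apply: addr_gt0.
  split; [exact: divr_gt0 | exact: exprn_gt0 |].
  exists 1%N => n n1; apply/andP; split; last first.
    by rewrite -exprD -natrX ler_nat addnC addnBA.
  rewrite mulrAC ler_pdivrMr // [leRHS]mulrC.
  have n0 : 0 < n%:R :> R by rewrite ltr0n.
  rewrite -(ler_pM2l n0) !mulrA; apply: le_trans (lower n) _.
  rewrite ler_wpM2r // mulrDr lerD2l ler_peMl ?ler1n //; exact: ltW.
Qed.
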